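(* Let $t\in\{2,\dots,T-1\}$, let $\boldsymbol{x}_{t-1}$ be a feasible previous-stage state and let $\boldsymbol{\xi}_t\in\Xi_t$. Suppose that the ambiguity sets in the value-function recursion are of Type 1, $\mathcal{P}_{t+1}(\boldsymbol{x}_t)=\mathcal{P}^{D_1}_{t+1}(\boldsymbol{x}_t)$ with $$\mathcal{P}_{t+1}^{D_1}(\boldsymbol{x}_t)=\Big\{\boldsymbol{p}\in\mathbb{R}_+^K:\ \underline{\boldsymbol{p}}(\boldsymbol{x}_t)\le \boldsymbol{p}\le \bar{\boldsymbol{p}}(\boldsymbol{x}_t),\ \boldsymbol{l}(\boldsymbol{x}_t)\le \sum_{k=1}^Kp_k\boldsymbol{f}(\boldsymbol{\xi}_{t+1}^k)\le\boldsymbol{u}(\boldsymbol{x}_t)\Big\},$$ and that $\mathcal{P}_{t+1}^{D_1}(\boldsymbol{x}_t)\neq\emptyset$ for every feasible $\boldsymbol{x}_t\in\hat X_t(\boldsymbol{x}_{t-1},\boldsymbol{\xi}_t)$. Then $Q_t(\boldsymbol{x}_{t-1},\boldsymbol{\xi}_t)$ equals the optimal value of $$\begin{aligned} \min_{\boldsymbol{\alpha},\boldsymbol{\beta},\underline{\boldsymbol{\gamma}},\bar{\boldsymbol{\gamma}},\boldsymbol{x}_t,\boldsymbol{y}_t}\quad & g_t(\boldsymbol{x}_t,\boldsymbol{y}_t)-\boldsymbol{\alpha}^{\mathsf T}\boldsymbol{l}(\boldsymbol{x}_t)+\boldsymbol{\beta}^{\mathsf T}\boldsymbol{u}(\boldsymbol{x}_t)-\underline{\boldsymbol{\gamma}}^{\mathsf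 T}\underline{\boldsymbol{p}}(\boldsymbol{x}_t)+\bar{\boldsymbol{\gamma}}^{\mathsf T}\bar{\boldsymbol{p}}(\boldsymbol{x}_t)\\ \text{s.t.}\quad & (-\boldsymbol{\alpha}+\boldsymbol{\beta})^{\mathsf T}\boldsymbol{f}(\boldsymbol{\xi}_{t+1}^k)-\underline{\gamma}_k+\bar{\gamma}_k\ge Q_{t+1}(\boldsymbol{x}_t,\boldsymbol{\xi}_{t+1}^k),\quad k=1,\dots,K,\\ & (\boldsymbol{x}_t,\boldsymbol{y}_t)\in X_t(\boldsymbol{x}_{t-1},\boldsymbol{\xi}_t),\\ & \boldsymbol{\alpha},\boldsymbol{\beta}\in\mathbb{R}^m_{+},\quad \underline{\boldsymbol{\gamma}},\bar{\boldsymbol{\gamma}}\in\mathbb{R}^K_{+}. \end{aligned}$$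
   Context: Setting (multistage decision-dependent distributionally robust mixed-integer program). Fix positive integers $T,I,J,K$. At each stage $t\in\{1,\dots,T\}$ the decisions are a binary state variable $\boldsymbol{x}_t\in\{0,1\}^I$ and a stage variable $\boldsymbol{y}_t\in\mathbb{R}^{I\times J}$ (components integer or continuous). $\boldsymbol{\xi}_1$ is deterministic; for $t\ge2$, $\boldsymbol{\xi}_t$ is a random vector with finite, decision-independent support $\Xi_t=\{\boldsymbol{\xi}_t^1,\dots,\boldsymbol{\xi}_t^K\}\subset\mathbb{R}^J$, and the $\boldsymbol{\xi}_t$ are stage-wise independent. The cost $g_t(\boldsymbol{x}_t,\boldsymbol{y}_t)$ is linear. The feasible set $X_t(\boldsymbol{x}_{t-1},\boldsymbol{\xi}_t)\subset\{0,1\}^I\times\mathbb{R}^{I\times J}$ is a non-empty compact mixed-integer polyhedral set for every feasible $\boldsymbol{x}_{t-1}$ and every realization $\boldsymbol{\xi}_t$ (complete recourse: every stage subproblem is always feasible). $\hat X_t(\boldsymbol{x}_{t-1},\boldsymbol{\xi}_t)$ denotes the projection of $X_t(\boldsymbol{x}_{t-1},\boldsymbol{\xi}_t)$ onto the $\boldsymbol{x}_t$-space. A probability distribution on $\Xi_{t+1}$ is identified with a vector $\boldsymbol{p}=(p_1,\dots,p_K)$, $p_k$ being the probability of $\boldsymbol{\xi}_{t+1}^k$. For each stage, $\mathcal{P}_{t+1}(\boldsymbol{x}_t)$ is a set of such distributions (ambiguity set) depending on $\boldsymbol{x}_t$. Value functions are defined by $$Q_T(\boldsymbol{x}_{T-1},\boldsymbol{\xi}_T)=\min_{(\boldsymbol{x}_T,\boldsymbol{y}_T)\in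 X_T(\boldsymbol{x}_{T-1},\boldsymbol{\xi}_T)} g_T(\boldsymbol{x}_T,\boldsymbol{y}_T),$$ and for $t=2,\dots,T-1$ by the Bellman equation $$Q_t(\boldsymbol{x}_{t-1},\boldsymbol{\xi}_t)=\min_{(\boldsymbol{x}_t,\boldsymbol{y}_t)\in X_t(\boldsymbol{x}_{t-1},\boldsymbol{\xi}_t)}\Big\{g_t(\boldsymbol{x}_t,\boldsymbol{y}_t)+\max_{\boldsymbol{p}\in\mathcal{P}_{t+1}(\boldsymbol{x}_t)}\sum_{k=1}^Kp_k\,Q_{t+1}(\boldsymbol{x}_t,\boldsymbol{\xi}_{t+1}^k)\Big\}.$$ Type 1 data: $\boldsymbol{f}=(f_1,\dots,f_m)^{\mathsf T}$ are moment functions $f_s(\boldsymbol{\xi})=\xi_1^{k_{s1}}\cdots\xi_J^{k_{sJ}}$ with non-negative integer exponents; $\boldsymbol{l}(\boldsymbol{x}_t),\boldsymbol{u}(\boldsymbol{x}_t)\in\mathbb{R}^m$ are given decision-dependent lower/upper bounds on the moments; $\underline{\boldsymbol{p}}(\boldsymbol{x}_t),\bar{\boldsymbol{p}}(\boldsymbol{x}_t)\in\mathbb{R}^K$ are given decision-dependent lower/upper bounds on the probabilities. By convention the moment constraints include the normalization $f_1\equiv1$, $l_1=u_1=1$, so that $\sum_kp_k=1$. Vector inequalities are componentwise. *)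

(* Defs.v *)
From HB Require Import structures.
From mathcomp Require Import all_boot all_order all_algebra.
From mathcomp Require Import all_classical all_reals all_analysis.

Set Implicit Arguments.
Unset Strict Implicit.
Unset Printing Implicit Defensive.

Import Order.TTheory GRing.Theory Num.Theory.
Import numFieldNormedType.Exports.

Local Open Scope classical_set_scope.
Local Open Scope ring_scope.

Section Vectors.
Context {R : realType}.

Definition dotv {n : nat} (u v : 'rV[R]_n) : R := \sum_(i < n) u 0 i * v 0 i.

Definition lev {n : nat} (u v : 'rV[R]_n) : Prop := forall i, u 0 i <= v 0 i.

Definition is_min (A : set R) (v : R) : Prop := A v /\ lbound A v.

Definition prob_simplex (K : nat) : set 'rV[R]_K :=
  [set p | lev 0 p /\ \sum_(k < K) p 0 k = 1].

End Vectors.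

Arguments prob_simplex {R} K.

Notation state I := 'rV[bool]_I.

Definition real_state (R : realType) (I : nat) (x : state I) : 'rV[R]_I :=
  map_mx (fun b : bool => b%:R) x.

Section Model.
Context {R : realType} {T I J K : nat}.

(** Stages are numbered from 1. [scen t k] is the [k]-th point of the support
    of the stage-[t] random vector and is meaningful for [t >= 2]; [scen1] is the
    deterministic stage-1 vector and [init] the data preceding stage 1.
    [ints t] lists the integer components of the stage variable. By stage-wise
    independence, [amb t x] does not depend on past realizations. *)
Record program := Program {
  init : state I;
  scen1 : 'rV[R]_J;
  scen : nat -> 'I_K -> 'rV[R]_J;
  cost : nat -> {linear ('rV[R]_I * 'M[R]_(I, J))%type -> R^o};
  ints : nat -> {set 'I_I * 'I_J};
  feas : nat -> state I -> 'rV[R]_J -> set (state I * 'M[R]_(I, J));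
  amb : nat -> state I -> set 'rV[R]_K
}.

Implicit Types (D : program) (t : nat) (x : state I) (xi : 'rV[R]_J).

Definition stage_cost D t (z : state I * 'M[R]_(I, J)) : R :=
  cost D t (real_state R z.1, z.2).

Definition outcomes D t : set 'rV[R]_J :=
  if t == 1%N then [set scen1 D] else range (scen D t).

Definition feas_state D t x xi : set (state I) :=
  [set z.1 | z in feas D t x xi].

(** States that can occur at the end of stage [t]. *)
Fixpoint reachable D t : set (state I) :=
  if t is s.+1 then
    [set x' | exists x xi,
      [/\ reachable D s x, outcomes D s.+1 xi & feas_state D s.+1 x xi x']]
  else [set init D].

Definition mixed_integer_polyhedral (Z : {set 'I_I * 'I_J})
    (S : set (state I * 'M[R]_(I, J))) : Prop :=
  exists (n : nat) (A : {linear ('rV[R]_I * 'M[R]_(I, J))%type -> 'rV[R]_n})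
         (b : 'rV[R]_n),
    S = [set z | lev (A (real_state R z.1, z.2)) b /\
                 forall ij, ij \in Z -> z.2 ij.1 ij.2 \is a Num.int].

Record well_posed D : Prop := WellPosed {
  wp_feas_nonempty : forall t x xi, (1 <= t <= T)%N ->
    reachable D t.-1 x -> outcomes D t xi -> feas D t x xi !=set0;
  wp_feas_compact : forall t x xi, (1 <= t <= T)%N ->
    reachable D t.-1 x -> outcomes D t xi -> compact (feas D t x xi);
  wp_feas_polyhedral : forall t x xi, (1 <= t <= T)%N ->
    reachable D t.-1 x -> outcomes D t xi ->
    mixed_integer_polyhedral (ints D t) (feas D t x xi);
  wp_amb : forall t x, (1 <= t < T)%N -> amb D t.+1 x `<=` prob_simplex K
}.

(** [value_from D n t] is the stage-[t] value function of the program with [n]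
    further stages after [t]. The minimum and maximum are written with [inf] and
    [sup] to obtain a total function; over a nonempty compact feasible set and a
    nonempty ambiguity set these are infima and suprema of nonempty sets that are
    bounded on the relevant side. *)
Fixpoint value_from D (n t : nat) x xi : R :=
  inf [set stage_cost D t z +
           (if n is n'.+1 then
              sup [set \sum_(k < K) p 0 k *
                         value_from D n' t.+1 z.1 (scen D t.+1 k)
                  | p in amb D t.+1 z.1]
            else 0)
      | z in feas D t x xi].

Definition Q D t x xi : R := value_from D (T - t) t x xi.

Lemma Q_last D x xi :
  Q D T x xi = inf [set stage_cost D T z | z in feas D T x xi].
Proof.
rewrite /Q subnn /=; congr inf.
by apply: eq_imagel => z _; rewrite addr0.
Qed.

Lemma Q_bellman D t x xi : (t < T)%N ->
  Q D t x xi =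
  inf [set stage_cost D t z +
           sup [set \sum_(k < K) p 0 k * Q D t.+1 z.1 (scen D t.+1 k)
               | p in amb D t.+1 z.1]
      | z in feas D t x xi].
Proof. by move=> tT; rewrite /Q -(subnSK tT). Qed.

(** There are [m.+1] moment functions; the normalization convention concerns
    the one of index [ord0]. *)
Record type1_data (m : nat) := Type1Data {
  expo : 'I_m.+1 -> 'I_J -> nat;
  mom_lo : state I -> 'rV[R]_m.+1;
  mom_up : state I -> 'rV[R]_m.+1;
  prob_lo : state I -> 'rV[R]_K;
  prob_up : state I -> 'rV[R]_K;
  norm_mom : forall xi : 'rV[R]_J,
    \prod_(j < J) xi 0 j ^+ expo ord0 j = 1;
  norm_lo : forall x, mom_lo x 0 ord0 = 1;
  norm_up : forall x, mom_up x 0 ord0 = 1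
}.

Definition moments (m : nat) (M : type1_data m) xi : 'rV[R]_m.+1 :=
  \row_s \prod_(j < J) xi 0 j ^+ expo M s j.

(** The stage-[t] Type 1 ambiguity set, [x] being the state of stage [t - 1]. *)
Definition amb_type1 D (m : nat) (M : type1_data m) t x : set 'rV[R]_K :=
  [set p | [/\ lev 0 p,
               lev (prob_lo M x) p /\ lev p (prob_up M x) &
               let mu := \sum_(k < K) p 0 k *: moments M (scen D t k) in
               lev (mom_lo M x) mu /\ lev mu (mom_up M x)]].

Record dual_point (m : nat) := DualPoint {
  alpha : 'rV[R]_m.+1;
  beta : 'rV[R]_m.+1;
  gamma_lo : 'rV[R]_K;
  gamma_up : 'rV[R]_K;
  dec_x : state I;
  dec_y : 'M[R]_(I, J)
}.

Definition dual_feasible D (m : nat) (M : type1_data m) t x xi :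
    set (dual_point m) :=
  [set d | [/\ forall k : 'I_K,
                 Q D t.+1 (dec_x d) (scen D t.+1 k) <=
                 dotv (- alpha d + beta d) (moments M (scen D t.+1 k))
                 - gamma_lo d 0 k + gamma_up d 0 k,
               feas D t x xi (dec_x d, dec_y d),
               lev 0 (alpha d) /\ lev 0 (beta d) &
               lev 0 (gamma_lo d) /\ lev 0 (gamma_up d)]].

Definition dual_objective D (m : nat) (M : type1_data m) t
    (d : dual_point m) : R :=
  stage_cost D t (dec_x d, dec_y d)
  - dotv (alpha d) (mom_lo M (dec_x d)) + dotv (beta d) (mom_up M (dec_x d))
  - dotv (gamma_lo d) (prob_lo M (dec_x d))
  + dotv (gamma_up d) (prob_up M (dec_x d)).

End Model.

Arguments program : clear implicits.
Arguments type1_data : clear implicits.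
Arguments dual_point : clear implicits.
Arguments well_posed {R} T {I J K} D.
Arguments Q {R} T {I J K} D t x xi.
Arguments dual_feasible {R} T {I J K} D {m} M t x xi _.

(* Main.v *)
Require Import Defs.
From HB Require Import structures.
From mathcomp Require Import all_boot all_order all_algebra.
From mathcomp Require Import all_classical all_reals all_analysis.
From mathcomp Require Import ring lra.
Import Order.TTheory GRing.Theory Num.Theory.
Import numFieldNormedType.Exports.
Local Open Scope classical_set_scope.
Local Open Scope ring_scope.

(** Both sides minimize over the same decisions [(x_t, y_t)] with the same cost,
so the theorem is linear programming duality for the inner maximization plus
attainment of the outer minimum.

For a fixed state, [amb_type1] is the solution set of finitely many linear
inequalities in [p], and the worst-case expectation is the supremum of a linear
form on it. Weak duality ([type1_weak_duality]) bounds that supremum by the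
dual objective of every feasible multiplier, which shows that the value function
is a lower bound of the reformulation. Strong duality with an attained dual
optimum ([type1_strong_duality]) provides multipliers whose objective does not
exceed the supremum; it needs the ambiguity set to be nonempty and the supremum
to be a finite upper bound, which it is because the set lies in the
probability simplex. It rests on the affine Farkas lemma ([affine_farkas]): a
linear inequality valid on a nonempty polyhedron is a nonnegative combination of
the defining inequalities, up to weakening the right-hand side.

The minimum is attained because the worst-case expectation depends on the
decision only through the binary state. States form a discrete space, so any
function of the state is continuous, whatever the dependence of the ambiguity
set on it, and a continuous function reaches its minimum on the compact feasible
set ([stage_min_attained]). At a minimizer the dual optimum turns the lower
bound into an equality. *)

(** * Farkas lemma *)

Lemma scalar_form0 (R : nzRingType) (V : lmodType R) (f : V -> R) :
  scalar f -> f 0 = 0.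
Proof.
by move=> sf; have := sf (-1) 0 0; rewrite scaler0 addr0 mulN1r addNr.
Qed.

(** Induction on the number of forms, after Bartl, which avoids any closedness
or separation argument. If the form [a j] is needed, some [z] satisfies the
other inequalities, violates [d w <= 0], and can be scaled so that [a j z = 1];
projecting every form along [z] eliminates [a j], and the sign of its
multiplier is read off at [z]. A list of indices carries the induction; as it is
duplicate-free, the multipliers are a function of the index. *)
Lemma farkas_seq (R : realFieldType) (V : lmodType R) (S : eqType)
    (a : S -> V -> R) (d : V -> R) (r : seq S) :
  uniq r -> (forall i, scalar (a i)) -> scalar d ->
  (forall w, (forall i, i \in r -> a i w <= 0) -> d w <= 0) ->
  exists2 y : S -> R, forall i, 0 <= y i &
    forall w, d w = \sum_(i <- r) y i * a i w.
Proof.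
elim: r a d => [|j r IH] a d /=.
  move=> _ _ sd dle; exists (fun=> 0) => // w; rewrite big_nil.
  have dN : d (- w) = - d w.
    by have := sd (-1) w 0; rewrite scaleN1r addr0 scalar_form0// addr0 mulN1r.
  have h1 : d w <= 0 by exact: dle.
  have h2 : d (- w) <= 0 by exact: dle.
  by apply/eqP; rewrite eq_le h1 -oppr_le0 -dN.
move=> /andP[jr ur] sa sd dle.
have [Hr|] := pselect (forall w, (forall i, i \in r -> a i w <= 0) -> d w <= 0).
  have [y y0 dE] := IH a d ur sa sd Hr.
  exists (fun i => if i == j then 0 else y i) => [i|w]; first by case: ifP.
  rewrite big_cons eqxx mul0r add0r dE; apply: eq_big_seq => i ir.
  by case: eqP ir jr => // -> ->.
move=> /existsNP[z0 /not_implyP[z0r /negP]]; rewrite -ltNge => dz0.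
have ajz0 : 0 < a j z0.
  rewrite ltNge; apply/negP => ajz0; move: dz0; rewrite ltNge => /negP; apply.
  by apply: dle => i; rewrite inE => /predU1P[->|/z0r].
pose z := (a j z0)^-1 *: z0.
have scz (f : V -> R) : scalar f -> f z = (a j z0)^-1 * f z0.
  by move=> sf; have := sf (a j z0)^-1 z0 0; rewrite scalar_form0// !addr0.
have ajz : a j z = 1 by rewrite scz// mulVf// gt_eqF.
have azle i : i \in r -> a i z <= 0.
  by move=> ir; rewrite scz// pmulr_rle0 ?invr_gt0// z0r.
have dz : 0 < d z by rewrite scz// mulr_gt0// invr_gt0.
(* [proj f] is [f] precomposed with the projection onto the kernel of [a j]
   along [z]. *)
pose proj (f : V -> R) w := f w - f z * a j w.
have sproj f : scalar f -> scalar (proj f).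
  by move=> sf c u v; rewrite /proj sf sa; ring.
have projE f w : scalar f -> proj f w = f (- a j w *: z + w).
  by move=> sf; rewrite /proj sf; ring.
have [w hw|y y0 dE] :=
    IH (fun i => proj (a i)) (proj d) ur (fun i => sproj _ (sa i)) (sproj _ sd).
  rewrite projE//; apply: dle => i; rewrite inE => /predU1P[->|ir].
    by rewrite sa ajz mulr1 addNr.
  by rewrite -projE//; exact: hw.
(* Evaluating the decomposition at [z], where [a j] is 1, dictates [yj]. *)
pose yj := d z - \sum_(i <- r) y i * a i z.
exists (fun i => if i == j then yj else y i) => [i|w].
  case: ifP => // _; rewrite subr_ge0 (le_trans _ (ltW dz))//.
  rewrite big_seq sumr_le0//.
  by move=> k kr; rewrite mulr_ge0_le0// azle.
rewrite big_cons eqxx.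
have -> : \sum_(i <- r) (if i == j then yj else y i) * a i w
        = \sum_(i <- r) y i * a i w.
  by apply: eq_big_seq => i ir; case: eqP ir jr => // -> ->.
have := dE w; rewrite /proj /yj mulrBl mulr_suml.
under eq_bigr do rewrite mulrBr mulrA.
rewrite sumrB => /eqP; rewrite subr_eq => /eqP ->; ring.
Qed.

(** Homogenization: a second coordinate [s >= 0] turns the affine inequalities
into the homogeneous ones [a i p <= b i * s]. The multiplier of [s >= 0] is
the slack in the final inequality. *)
Lemma affine_farkas (R : realFieldType) (V : lmodType R) (S : finType)
    (a : S -> V -> R) (b : S -> R) (c : V -> R) (v : R) :
  (forall i, scalar (a i)) -> scalar c ->
  (exists p, forall i, a i p <= b i) ->
  (forall p, (forall i, a i p <= b i) -> c p <= v) ->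
  exists y : S -> R, [/\ forall i, 0 <= y i,
    forall p, c p = \sum_i y i * a i p & \sum_i y i * b i <= v].
Proof.
move=> sa sc [p0 ap0] cle.
(* The index [None] stands for the constraint [0 <= s]. *)
pose A (o : option S) (w : V * R^o) : R :=
  if o is Some i then a i w.1 - b i * w.2 else - w.2.
pose C (w : V * R^o) : R := c w.1 - v * w.2.
have sA o : scalar (A o).
  by case: o => [i|] e u w; rewrite /A /= ?sa /GRing.scale/=; ring.
have sC : scalar C by move=> e u w; rewrite /C /= sc /GRing.scale/=; ring.
pose r : seq (option S) := None :: map Some (index_enum S).
have ur : uniq r.
  rewrite /= map_inj_uniq ?index_enum_uniq; last by move=> ? ? [].
  by rewrite andbT; apply/mapP => -[].
have [[p s] hps|y y0 CE] := farkas_seq _ _ _ A C r ur sA sC.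
  have hN i : a i p <= b i * s.
    have ir : Some i \in r by rewrite inE; apply: map_f; exact: mem_index_enum.
    by have := hps _ ir; rewrite /A/= subr_le0.
  have := hps None (mem_head _ _); rewrite /A/= oppr_le0 le_eqVlt.
  case/orP => [/eqP s0E|s_gt0].
    (* For [s = 0], [p] is a recession direction: a large step [e] along it from
       the feasible point [p0] would reach the value [v + 1]. *)
    rewrite /C/= -s0E mulr0 subr0 leNgt; apply/negP => cp.
    have cp0 : c p0 <= v := cle _ ap0.
    pose e := (v - c p0 + 1) / c p.
    have e0 : 0 <= e by rewrite divr_ge0 ?(ltW cp)// addr_ge0 ?subr_ge0.
    have : c (e *: p + p0) <= v.
      apply: cle => i; rewrite sa -[leRHS]add0r lerD ?ap0//.
      by rewrite mulr_ge0_le0// (le_trans (hN i))// -s0E mulr0.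
    rewrite sc /e divfK ?gt_eqF//; lra.
  have : c (s^-1 *: p + 0) <= v.
    apply: cle => i; rewrite sa scalar_form0// addr0 mulrC ler_pdivrMr//.
  by rewrite sc scalar_form0// addr0 mulrC ler_pdivrMr// /C/= subr_le0.
have optE (F : option S -> R) :
    \sum_(o <- r) F o = F None + \sum_i F (Some i) by rewrite big_cons big_map.
exists (fun i => y (Some i)); split=> [//|p|].
  have := CE (p, 0).
  rewrite optE /A /C/= mulr0 oppr0 mulr0 add0r addr0 => ->.
  by apply: eq_bigr => i _; rewrite mulr0 subr0.
have := CE (0, 1); rewrite optE /A /C/= scalar_form0// mulr1 sub0r mulrN1.
under eq_bigr do rewrite scalar_form0// mulr1 sub0r mulrN.
rewrite sumrN => vE; have := y0 None; lra.
Qed.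

(** * Duality for Type 1 ambiguity sets *)

Section Dotv.
Context {R : realType} {n : nat}.
Implicit Types a b u v : 'rV[R]_n.

Lemma dotvNDl a b u : dotv (- a + b) u = - dotv a u + dotv b u.
Proof.
rewrite /dotv -sumrN -big_split; apply: eq_bigr => i _ /=.
by rewrite !mxE mulrDl mulNr.
Qed.

Lemma dotv_row (z : 'I_n -> R) u : dotv (\row_i z i) u = \sum_i z i * u 0 i.
Proof. by apply: eq_bigr => i _; rewrite mxE. Qed.

Lemma dotv_sumr K a (p : 'I_K -> R) (f : 'I_K -> 'rV[R]_n) :
  dotv a (\sum_k p k *: f k) = \sum_k p k * dotv a (f k).
Proof.
rewrite /dotv.
under eq_bigr do rewrite summxE mulr_sumr.
rewrite exchange_big /=; apply: eq_bigr => k _.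
by rewrite mulr_sumr; apply: eq_bigr => i _; rewrite !mxE mulrCA.
Qed.

Lemma ler_dotv a u v : lev 0 a -> lev u v -> dotv a u <= dotv a v.
Proof.
move=> a0 uv; apply: ler_sum => i _; apply: ler_wpM2l (uv i).
by have := a0 i; rewrite mxE.
Qed.

End Dotv.

Section Type1.
Context {R : realType} {T I J K m : nat}.
Implicit Types (D : program R I J K) (M : type1_data R I J K m).

Lemma type1_weak_duality D M t x (q : 'I_K -> R) p
    (al be : 'rV[R]_m.+1) (ga de : 'rV[R]_K) :
  amb_type1 D M t x p ->
  lev 0 al -> lev 0 be -> lev 0 ga -> lev 0 de ->
  (forall k, q k <= dotv (- al + be) (moments M (scen D t k))
                    - ga 0 k + de 0 k) ->
  \sum_k p 0 k * q k <=
    - dotv al (mom_lo M x) + dotv be (mom_up M x)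
    - dotv ga (prob_lo M x) + dotv de (prob_up M x).
Proof.
move=> [p0 [plo pup] [mlo mup]] al0 be0 ga0 de0 qle.
have q_le : \sum_k p 0 k * q k <= \sum_k p 0 k *
    (dotv (- al + be) (moments M (scen D t k)) - ga 0 k + de 0 k).
  apply: ler_sum => k _; apply: ler_wpM2l (qle k).
  by have := p0 k; rewrite mxE.
apply: (le_trans q_le).
have -> : \sum_k p 0 k *
    (dotv (- al + be) (moments M (scen D t k)) - ga 0 k + de 0 k) =
    dotv (- al + be) (\sum_k p 0 k *: moments M (scen D t k))
    - dotv ga p + dotv de p.
  rewrite dotv_sumr /dotv -sumrB -big_split; apply: eq_bigr => k _ /=; ring.
rewrite dotvNDl.
have := ler_dotv _ _ _ al0 mlo; have := ler_dotv _ _ _ be0 mup.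
have := ler_dotv _ _ _ ga0 plo; have := ler_dotv _ _ _ de0 pup; lra.
Qed.

(** The multipliers of the two moment and the two probability bounds are the
dual variables; those of [0 <= p] become the slack that makes the dual
constraint an inequality instead of an equality. *)
Lemma type1_strong_duality D M t x (q : 'I_K -> R) (v : R) :
  amb_type1 D M t x !=set0 ->
  (forall p, amb_type1 D M t x p -> \sum_k p 0 k * q k <= v) ->
  exists (al be : 'rV[R]_m.+1) (ga de : 'rV[R]_K), [/\
    forall k, q k <= dotv (- al + be) (moments M (scen D t k))
                     - ga 0 k + de 0 k,
    lev 0 al /\ lev 0 be, lev 0 ga /\ lev 0 de &
    - dotv al (mom_lo M x) + dotv be (mom_up M x)
    - dotv ga (prob_lo M x) + dotv de (prob_up M x) <= v].
Proof.
move=> ne qle.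
pose f k := moments M (scen D t k).
pose mu (p : 'rV[R]_K) := \sum_k p 0 k *: f k.
have muE p s : mu p 0 s = \sum_k p 0 k * f k 0 s.
  by rewrite summxE; apply: eq_bigr => k _; rewrite mxE.
have smu e p p' : mu (e *: p + p') = e *: mu p + mu p'.
  rewrite /mu scaler_sumr -big_split; apply: eq_bigr => k _ /=.
  by rewrite !mxE scalerDl scalerA.
(* One index per scalar inequality: nonnegativity, lower and upper probability
   bounds, lower and upper moment bounds. *)
pose a (o : ('I_K + 'I_K + 'I_K) + ('I_m.+1 + 'I_m.+1)) (p : 'rV[R]_K) : R :=
  match o with
  | inl (inl (inl k)) => - p 0 k
  | inl (inl (inr k)) => - p 0 k
  | inl (inr k) => p 0 k
  | inr (inl s) => - mu p 0 s
  | inr (inr s) => mu p 0 s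
  end.
pose b (o : ('I_K + 'I_K + 'I_K) + ('I_m.+1 + 'I_m.+1)) : R :=
  match o with
  | inl (inl (inl k)) => 0
  | inl (inl (inr k)) => - prob_lo M x 0 k
  | inl (inr k) => prob_up M x 0 k
  | inr (inl s) => - mom_lo M x 0 s
  | inr (inr s) => mom_up M x 0 s
  end.
pose c (p : 'rV[R]_K) : R := \sum_k p 0 k * q k.
have sa o : scalar (a o).
  case: o => [[[k|k]|k]|[s|s]] e p p' /=; rewrite ?smu !mxE; ring.
have sc : scalar c.
  move=> e p p'; rewrite /c mulr_sumr -big_split; apply: eq_bigr => k _ /=.
  by rewrite !mxE; ring.
have aP p : amb_type1 D M t x p <-> forall o, a o p <= b o.
  split=> [[p0 [plo pup] [mlo mup]] [[[k|k]|k]|[s|s]] /=|ap].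
  - by rewrite oppr_le0; have := p0 k; rewrite mxE.
  - by rewrite lerN2; exact: plo.
  - exact: pup.
  - by rewrite lerN2; exact: mlo.
  - exact: mup.
  split=> [k||].
  - by have := ap (inl (inl (inl k))); rewrite /= oppr_le0 mxE.
  - split=> k; last exact: (ap (inl (inr k))).
    by have := ap (inl (inl (inr k))); rewrite /= lerN2.
  - split=> s; last exact: (ap (inr (inr s))).
    by have := ap (inr (inl s)); rewrite /= lerN2.
have [|p /aP|y [y0 cE yb]] := @affine_farkas _ _ _ a b c v sa sc; last 2 first.
- exact: qle.
- exists (\row_s y (inr (inl s))), (\row_s y (inr (inr s))).
  exists (\row_k y (inl (inl (inr k)))), (\row_k y (inl (inr k))).
  split; try by split=> i; rewrite !mxE.
  + move=> k.
    (* The dual constraint at [k] compares the coefficients of [p 0 k] in the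
       identity [cE]. *)
    have ck : c (delta_mx 0 k) = q k.
      rewrite /c (bigD1 k)//= big1 => [|i ik]; rewrite !mxE ?eqxx.
        by rewrite mul1r addr0.
      by rewrite (negbTE ik) mul0r.
    have muk : mu (delta_mx 0 k) = f k.
      rewrite /mu (bigD1 k)//= big1 => [|i ik]; rewrite !mxE ?eqxx.
        by rewrite scale1r addr0.
      by rewrite (negbTE ik) scale0r.
    have sumk (z : 'I_K -> R) :
        \sum_i z i * (delta_mx 0 k : 'rV[R]_K) 0 i = z k.
      rewrite (bigD1 k)//= big1 => [|i ik]; rewrite !mxE ?eqxx.
        by rewrite mulr1 addr0.
      by rewrite (negbTE ik) mulr0.
    have := cE (delta_mx 0 k); rewrite ck !big_sumType /= muk.
    have sumNk (z : 'I_K -> R) :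
        \sum_i z i * - (delta_mx 0 k : 'rV[R]_K) 0 i = - z k.
      by under eq_bigr do rewrite mulrN; rewrite sumrN sumk.
    have sumNs (z : 'I_m.+1 -> R) : \sum_s z s * - f k 0 s =
        - \sum_s z s * f k 0 s.
      by rewrite -sumrN; apply: eq_bigr => s _; rewrite mulrN.
    rewrite !sumNk sumk sumNs dotvNDl !mxE => ->.
    rewrite !dotv_row; have := y0 (inl (inl (inl k))); lra.
  + move: yb; rewrite !big_sumType /= big1 => [|k _]; last exact: mulr0.
    have sumN n (z w : 'I_n -> R) : \sum_i z i * - w i = - \sum_i z i * w i.
      by rewrite -sumrN; apply: eq_bigr => i _; rewrite mulrN.
    rewrite !sumN !dotv_row; lra.
- by case: ne => p /aP pP; exists p.
Qed.

End Type1.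

(** * Attainment of the stage minimum *)

Lemma continuous_bool_mx (R : realType) (m n : nat) (h : 'M[bool]_(m, n) -> R) :
  continuous h.
Proof.
move=> x U hU; have : nbhs x [set x].
  exists (fun i j => [set x i j]) => [i j|y yx]; first exact: discrete_set1.
  by apply/matrixP => i j; rewrite (yx i j).
by apply: filterS => _ ->; exact: (nbhs_singleton hU).
Qed.

Lemma continuous_linear_mx (R : realType) (m n : nat)
    (L : {linear 'M[R]_(m, n) -> R^o}) : continuous (L : 'M[R]_(m, n) -> R).
Proof.
have -> : (L : 'M[R]_(m, n) -> R) =
    fun Y => \sum_i \sum_j Y i j * L (delta_mx i j).
  apply/funext => Y; rewrite {1}[Y]matrix_sum_delta linear_sum.
  apply: eq_bigr => i _; rewrite linear_sum; apply: eq_bigr => j _.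
  by rewrite linearZ.
move=> Y.
apply: (cvg_big add_continuous (nbhs_filter Y)) => i _.
apply: (cvg_big add_continuous (nbhs_filter Y)) => j _.
by apply: (@cvgMr_tmp _ _ (nbhs Y)); exact: coord_continuous.
Qed.

(** By linearity the cost splits into a function of the state, which merges with
[h], and a linear function of the stage variable. *)
Lemma stage_min_attained (R : realType) (I J K : nat) (D : program R I J K)
    (t : nat) (A : set (state I * 'M[R]_(I, J))) (h : state I -> R) :
  A !=set0 -> compact A ->
  exists2 z, A z & forall w, A w ->
    stage_cost D t z + h z.1 <= stage_cost D t w + h w.1.
Proof.
move=> A0 cA.
pose L Y : R^o := cost D t (0 : 'rV[R]_I, Y).
have sL : linear L.
  move=> e Y Y'; rewrite /L -linearP; congr (cost D t _).
  by rewrite [RHS]surjective_pairing /= scaler0 addr0.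
pose LL : {linear 'M[R]_(I, J) -> R^o} :=
  HB.pack L (GRing.isLinear.Build _ _ _ _ L sL).
pose H y : R := cost D t (real_state R y, 0 : 'M[R]_(I, J)) + h y.
have FE z : stage_cost D t z + h z.1 = H z.1 + LL z.2.
  rewrite /H addrAC; congr (_ + _); rewrite /LL /= /L /stage_cost -linearD.
  by congr (cost D t _); rewrite [RHS]surjective_pairing /= addr0 add0r.
have cF : continuous (fun z : state I * 'M[R]_(I, J) => H z.1 + LL z.2).
  move=> z; apply: cvgD.
    by apply: continuous_comp; [exact: cvg_fst|exact: continuous_bool_mx].
  apply: (@continuous_comp _ _ _ snd LL z cvg_snd).
  exact: continuous_linear_mx.
have [z zA zmin] := compact_EVT_min A0 cA (continuous_subspaceT cF).
exists z; first by rewrite inE in zA.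
by move=> w Aw; rewrite !FE; apply: zmin; rewrite inE.
Qed.

Theorem theorem1 (R : realType) (T I J K m : nat)
  (hT : (0 < T)%N) (hI : (0 < I)%N) (hJ : (0 < J)%N) (hK : (0 < K)%N)
  (D : program R I J K) (hD : well_posed T D)
  (M : type1_data R I J K m)
  (t : nat) (ht : (2 <= t <= T.-1)%N)
  (x : 'rV[bool]_I) (hx : reachable D t.-1 x)
  (xi : 'rV[R]_J) (hxi : outcomes D t xi)
  (hamb : forall x' : 'rV[bool]_I, amb D t.+1 x' = amb_type1 D M t.+1 x')
  (hne : forall x' : 'rV[bool]_I, feas_state D t x xi x' ->
           amb_type1 D M t.+1 x' !=set0) :
  is_min [set dual_objective D M t d | d in dual_feasible T D M t x xi]
         (Q T D t x xi).
Proof.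
have /andP[t2 tT1] := ht.
have tT : (t < T)%N by rewrite -(ltn_predK hT) ltnS.
have t1T : (1 <= t <= T)%N by rewrite (ltnW t2) ltnW.
pose q x' k : R := Q T D t.+1 x' (scen D t.+1 k).
pose W x' : R := sup [set \sum_k p 0 k * q x' k | p in amb_type1 D M t.+1 x'].
(* [sup] is 0 on an unbounded set, so the bound given by the simplex matters. *)
have W_ub x' p : amb_type1 D M t.+1 x' p -> \sum_k p 0 k * q x' k <= W x'.
  move=> px'; apply: ub_le_sup; last by exists p.
  exists (\sum_k `|q x' k|) => _ [p' p'x' <-]; apply: ler_sum => k _.
  have [p'0 p'1] : prob_simplex K p'.
    by apply: (wp_amb hD (t := t) (x := x')); rewrite ?(ltnW t2)// hamb.
  have p'_ge0 i : 0 <= p' 0 i by have := p'0 i; rewrite mxE.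
  rewrite (le_trans (ler_norm _))// normrM ger0_norm// ler_piMl//.
  by rewrite -p'1 (bigD1 k)//= lerDl sumr_ge0.
have QE : Q T D t x xi =
    inf [set stage_cost D t z + W z.1 | z in feas D t x xi].
  rewrite Q_bellman//; congr inf; apply: eq_imagel => z _.
  by rewrite hamb.
have [z Az zmin] := stage_min_attained _ _ _ _ D t _ W
  (wp_feas_nonempty hD t1T hx hxi) (wp_feas_compact hD t1T hx hxi).
have Qz : Q T D t x xi = stage_cost D t z + W z.1.
  rewrite QE; apply/eqP; rewrite eq_le; apply/andP; split.
    apply: ge_inf; last by exists z.
    by exists (stage_cost D t z + W z.1) => _ [w Aw <-]; exact: zmin.
  apply: lb_le_inf; first by exists (stage_cost D t z + W z.1), z.
  by move=> _ [w Aw <-]; exact: zmin.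
have neA w : feas D t x xi w -> amb_type1 D M t.+1 w.1 !=set0.
  by move=> Aw; apply: hne; exists w.
have Qlb : lbound [set dual_objective D M t d | d in dual_feasible T D M t x xi]
    (Q T D t x xi).
  move=> _ [d [dk dA [al0 be0] [ga0 de0]] <-].
  rewrite Qz (le_trans (zmin _ dA))// /dual_objective -!addrA lerD2l !addrA.
  have [p0 p0A] := neA _ dA.
  apply: ge_sup; first by exists (\sum_k p0 0 k * q (dec_x d) k), p0.
  by move=> _ [p pA <-]; exact: type1_weak_duality pA al0 be0 ga0 de0 dk.
split=> //.
have [al [be [ga [de [qle ab0 gd0 dle]]]]] :=
  type1_strong_duality D M t.+1 z.1 (q z.1) (W z.1) (neA _ Az) (W_ub z.1).
pose d := DualPoint al be ga de z.1 z.2.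
have dF : dual_feasible T D M t x xi d.
  by split=> //=; rewrite -surjective_pairing.
exists d => //; apply/eqP; rewrite eq_le Qlb ?andbT; last by exists d.
by rewrite Qz /dual_objective /= -surjective_pairing -!addrA lerD2l !addrA.
Qed.
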